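(* Let $L$ and $L'$ be languages (value sets $\mathbf V,\mathbf V'$) satisfying the Alpha Postulate, and let $\precsim$ be a preorder (on a set containing $\mathbf V\cup\mathbf V'$) that respects $\equiv^\alpha_L$ and $\equiv^\alpha_{L'}$. Then every compositional fvr-translation $T:\mathbb T_L\to\mathbb T_{L'}$ that preserves $\precsim$ is valid up to $\precsim$.
   Context: Fix a sufficiently large (infinite) set $\mathcal V$ of variables. A language $L$ has a set $\mathbb T_L$ of expressions built inductively from variables by operators and possibly other (possibly binding) constructs; $\mathrm{fv}(E)$ denotes free variables. Semantics: $[\![\cdot]\!]_L:\mathbb T_L\to((\mathcal V\to\mathbf V)\to\mathbf V)$ with $[\![X]\!]_L(\rho)=\rho(X)$, $[\![E]\!]_L(\rho)$ depending only on $\rho|_{\mathrm{fv}(E)}$, and (standing assumption) for all $E$, substitutions $\sigma$ and valuations $\rho$ there is $F=_\alpha E$ with $[\![E[\sigma]]\!]_L(\rho)=[\![F]\!]_L([\![\sigma]\!]_L(\rho))$, where $[\![\sigma]\!]_L(\rho)(X)=[\![\sigma(X)]\!]_L(\rho)$. Substitutions act by capture-avoiding replacement; $=_\alpha$ is $\alpha$-convertibility. $v\equiv^\alpha_L w$ iff there are $E=_\alpha F$ and a valuation $\zeta$ with $[\![E]\!]_L(\zeta)=v$, $[\![F]\!]_L(\zeta)=w$; Alpha Postulate: $\equiv^\alpha_L$ is an equivalence; $\precsim$ respects $\equiv^\alpha_L$ if $\equiv^\alpha_L\subseteq\,\precsim$. A translation $T$ is compositional if $T(E[\sigma])=_\alpha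 T(E)[T\circ\sigma]$ for all $E$ and $\sigma:\mathrm{fv}(E)\to\mathbb T_L$, $E=_\alpha F$ implies $T(E)=_\alpha T(F)$, and $T(X)=X$ for $X\in\mathcal V$. $T$ is an fvr-translation if $\mathrm{fv}(T(E))\subseteq\mathrm{fv}(E)$ for all $E$. $T$ preserves $\precsim$ if there is a map $\mathbf T:\mathbf V\to\mathbf V'$ with $\mathbf T(v)\precsim v$ for all $v\in\mathbf V$ and $[\![T(E)]\!]_{L'}(\mathbf T\circ\rho)\precsim[\![E]\!]_L(\rho)$ for all $E\in\mathbb T_L$ and all $\rho:\mathcal V\to\mathbf V$. A semantic translation is $R\subseteq\mathbf V'\times\mathbf V$ with every $v\in\mathbf V$ having some $v'Rv$; $T$ is correct w.r.t. $R$ if $[\![T(E)]\!]_{L'}(\eta)\,R\,[\![E]\!]_L(\rho)$ whenever $\eta(X)R\rho(X)$ for all $X$; $T$ is valid up to $\precsim$ if correct w.r.t. some semantic translation $R\subseteq\,\precsim$. *)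

(* Defs.v *)
From Stdlib Require Export RelationClasses.
From mathcomp Require Export all_boot.
From mathcomp Require Export boolp classical_sets functions cardinality.

Set Implicit Arguments.
Unset Strict Implicit.
Unset Printing Implicit Defensive.

Local Open Scope classical_set_scope.

(* Single-sorted languages with binding.  A construct c has arguments indexed
   by [arity c] (of any size, so that infinite sums or infinite systems of
   recursion equations are allowed) and declares bound variables in the slots
   [binder c]; slot j binds in argument i when j belongs to [scope c i].
   A slot may bind in several arguments, as in letrec, or in only some of them.
   An operator is a construct without binders. *)
Record signature := Signature {
  construct :> Type;
  arity : construct -> Type;
  binder : construct -> Type;
  scope : forall c : construct, arity c -> set (binder c)
}.
Arguments arity {s} c.
Arguments binder {s} c.
Arguments scope {s c} i.

(* Two slots that bind in the same argument must hold different variables;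
   slots with disjoint scopes may share a variable. *)
Definition admissible (V : Type) (S : signature) (c : S) (b : binder c -> V) :=
  forall (i : arity c) (j k : binder c),
    scope i j -> scope i k -> b j = b k -> j = k.

(* Raw named syntax: alpha-convertible expressions are not identified. *)
Inductive expr (V : Type) (S : signature) : Type :=
| Var : V -> expr V S
| Con : forall (c : S) (b : binder c -> V),
    admissible b -> (arity c -> expr V S) -> expr V S.
Arguments Var {V S} X.
Arguments Con {V S} c b hb a.

Section Syntax.
Variables (V : Type) (S : signature).
Implicit Types (c : S) (X Z : V) (E F G : expr V S) (s t : V -> expr V S).

Definition bound_in c (b : binder c -> V) (i : arity c) : set V :=
  b @` scope i.

Fixpoint fv E : set V :=
  match E with
  | Var X => [set X]
  | Con c b _ a => \bigcup_(i in [set: arity c]) (fv (a i) `\` bound_in b i)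
  end.

(* t is the substitution to be performed inside argument i when s is applied to
   an expression with binders b and these binders are renamed into b'. *)
Definition under_binders c (b b' : binder c -> V) (i : arity c) s t :=
  (forall j, scope i j -> t (b j) = Var (b' j)) /\
  (forall Z, ~ bound_in b i Z -> t Z = s Z).

(* A variable of this set gets captured if it is bound in argument i. *)
Definition incoming c (b : binder c -> V) (a : arity c -> expr V S) s
    (i : arity c) : set V :=
  \bigcup_(Z in fv (a i) `\` bound_in b i) fv (s Z).

(* [is_subst s E E']: E' results from E by simultaneously replacing its free
   variables according to s; a bound variable is renamed only if it would
   otherwise capture a variable, and then the new name is arbitrary as long as
   it does not capture anything either.  Being a relation, this covers every
   convention for choosing the new names.  A partial substitution is rendered
   as a total one that is the identity [Var] outside its domain. *)
Inductive is_subst : (V -> expr V S) -> expr V S -> expr V S -> Prop :=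
| is_subst_var s X : is_subst s (Var X) (s X)
| is_subst_con s c (b b' : binder c -> V) (hb : admissible b)
    (hb' : admissible b') (a a' : arity c -> expr V S)
    (t : arity c -> V -> expr V S) :
    (forall j, (forall i, scope i j -> ~ incoming b a s i (b j)) ->
       b' j = b j) ->
    (forall i j, scope i j -> ~ incoming b a s i (b' j)) ->
    (forall i, under_binders b b' i s (t i)) ->
    (forall i, is_subst (t i) (a i) (a' i)) ->
    is_subst s (Con c b hb a) (Con c b' hb' a').

(* Alpha-convertibility: the least congruence containing the renamings of the
   binders of a construct into variables not free in the arguments concerned. *)
Inductive alpha : expr V S -> expr V S -> Prop :=
| alpha_refl E : alpha E E
| alpha_sym E F : alpha E F -> alpha F E
| alpha_trans E F G : alpha E F -> alpha F G -> alpha E G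
| alpha_cong c (b : binder c -> V) (hb : admissible b)
    (a a' : arity c -> expr V S) :
    (forall i, alpha (a i) (a' i)) -> alpha (Con c b hb a) (Con c b hb a')
| alpha_rename c (b b' : binder c -> V) (hb : admissible b)
    (hb' : admissible b') (a a' : arity c -> expr V S)
    (t : arity c -> V -> expr V S) :
    (forall i j, scope i j -> ~ (fv (a i) `\` bound_in b i) (b' j)) ->
    (forall i, under_binders b b' i Var (t i)) ->
    (forall i, is_subst (t i) (a i) (a' i)) ->
    alpha (Con c b hb a) (Con c b' hb' a').

(* V is sufficiently large for S: some infinite regular cardinal K <= |V|
   exceeds the number of arguments and of binders of each construct.  Then every
   expression contains fewer than |V| variables, so fresh ones can be found.
   If these numbers are all finite, this just says that V is infinite (see
   [sufficiently_large_finitary]). *)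
Definition below (I : Type) (K : set V) (A : set I) := ~ (K #<= A)%card.

Definition regular (K : set V) :=
  infinite_set K /\
  forall (I : set V) (A : V -> set V), below K I ->
    (forall i, I i -> below K (A i)) -> below K (\bigcup_(i in I) A i).

Definition sufficiently_large :=
  exists2 K : set V, regular K &
    forall c, below K [set: arity c] /\ below K [set: binder c].

End Syntax.
Arguments sufficiently_large V S : clear implicits.

Lemma sufficiently_large_finitary (V : Type) (S : signature) :
  (forall c : S, finite_set [set: arity c] /\ finite_set [set: binder c]) ->
  sufficiently_large V S <-> infinite_set [set: V].
Proof.
move=> fin; have fin_below U T (K : set U) (A : set T) :
    infinite_set K -> finite_set A -> below K A.
  by move=> Kinf Afin KA; apply/Kinf/(card_le_finite KA).
split=> [[K [Kinf _] _]|]; first exact: sub_infinite_set Kinf.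
elim/Ppointed: V => V; first by rewrite empty_eq0 => /(_ (finite_set0 _)).
move=> /infiniteP/pcard_injP[f f_inj].
have K_nat : (range f #= [set: nat])%card by exact: inj_card_eq.
have Kinf : infinite_set (range f).
  by rewrite (eq_finite_set K_nat); exact: infinite_nat.
have below_fin T (A : set T) : below (range f) A -> finite_set A.
  move=> KA; apply: contrapT => /infiniteP nat_A; apply: KA.
  by rewrite (card_le_eql K_nat).
exists (range f) => [|c]; last by have [? ?] := fin c; split; exact: fin_below.
split=> // I A /below_fin finI belowA; apply: fin_below => //.
by apply: bigcup_finite => // i /belowA /below_fin.
Qed.

(* The value set D is an arbitrary type; [sub E s] is the expression E[s]. *)
Record language (V D : Type) := Language {
  syntax : signature;
  sub : expr V syntax -> (V -> expr V syntax) -> expr V syntax;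
  subP : forall E s, is_subst s E (sub E s);
  sem : expr V syntax -> (V -> D) -> D;
  sem_var : forall X rho, sem (Var X) rho = rho X;
  sem_fv : forall E rho rho',
    (forall X, fv E X -> rho X = rho' X) -> sem E rho = sem E rho';
  sem_sub : forall E s rho, exists2 F, alpha F E &
    sem (sub E s) rho = sem F (fun X => sem (s X) rho)
}.
Arguments sub {V D l} E s.
Arguments sem {V D l} E rho.

Definition term (V D : Type) (L : language V D) := expr V (syntax L).

Definition alpha_sem (V D : Type) (L : language V D) (v w : D) : Prop :=
  exists (E F : term L) (zeta : V -> D),
    [/\ alpha E F, sem E zeta = v & sem F zeta = w].

Definition alpha_postulate (V D : Type) (L : language V D) : Prop :=
  Equivalence (@alpha_sem V D L).

Section Translations.
Variables (V U : Type) (le : U -> U -> Prop) (D D' : set U).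
Variables (L : language V D) (L' : language V D').

Definition respects_alpha (A : set U) (M : language V A) : Prop :=
  forall v w : A, alpha_sem M v w -> le (set_val v) (set_val w).

Definition compositional (T : term L -> term L') : Prop :=
  [/\ forall (E : term L) (s : V -> term L),
        (forall X, ~ fv E X -> s X = Var X) ->
        alpha (T (sub E s)) (sub (T E) (T \o s)),
      forall E F : term L, alpha E F -> alpha (T E) (T F) &
      forall X : V, T (Var X) = Var X].

Definition fvr_translation (T : term L -> term L') : Prop :=
  forall E : term L, fv (T E) `<=` fv E.

Definition preserves (T : term L -> term L') : Prop :=
  exists2 TT : D -> D',
    forall v : D, le (set_val (TT v)) (set_val v) &
    forall (E : term L) (rho : V -> D),
      le (set_val (sem (T E) (TT \o rho))) (set_val (sem E rho)).

Definition semantic_translation (R : D' -> D -> Prop) : Prop :=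
  forall v : D, exists v' : D', R v' v.

Definition correct (T : term L -> term L') (R : D' -> D -> Prop) : Prop :=
  forall (E : term L) (eta : V -> D') (rho : V -> D),
    (forall X, R (eta X) (rho X)) -> R (sem (T E) eta) (sem E rho).

Definition valid_up_to (T : term L -> term L') : Prop :=
  exists R : D' -> D -> Prop,
    [/\ semantic_translation R,
        forall v' v, R v' v -> le (set_val v') (set_val v) &
        correct T R].

End Translations.

(* Main.v *)
(** Relate v' to v when, up to the semantic alpha-equivalences, they have the
forms [[T(E)]](TT o rho) and [[E]](rho).  To see that T is correct with respect
to this relation, let E_X and rho_X witness that eta(X) is related to rho(X),
for X free in E, and rename the variables of the E_X apart, so that a single
valuation serves them all: there are fewer than K of them.  Substituting the
renamed E_X into E, and using compositionality on the side of T, one obtains a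
witness for the pair [[T(E)]](eta), [[E]](rho).

This needs that the semantic alpha-equivalence is a congruence.  The difficulty
there is that the semantics of a renamed term is given up to
alpha-equivalence only, which is of no use inside an argument.  However, a term
E is itself a renaming, by the inverse, of the term E' obtained by renaming its
free variables into entirely fresh ones; hence [[E]](rho) is exactly the value
of some term alpha-convertible to E'. *)
Require Import Defs.
From mathcomp Require Import all_boot boolp classical_sets functions cardinality.

Set Implicit Arguments.
Unset Strict Implicit.
Unset Printing Implicit Defensive.

Local Open Scope classical_set_scope.

(** * Comparison of the cardinalities of sets *)

Lemma card_le_inj T U (A : set T) (B : set U) (u : U) :
  (A #<= B)%card -> exists2 f : T -> U, set_fun A B f & set_inj A f.
Proof.
elim/Ppointed: U => U in B u *; first by have [] := @no U u.
by move=> /pcard_leP /injfunPex.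
Qed.

Lemma inj_card_le_set T U (A : set T) (B : set U) (f : T -> U) :
  set_fun A B f -> set_inj A f -> (A #<= B)%card.
Proof.
move=> fAB f_inj.
have [g] : $|{injfun A >-> B}| by apply/injfunPex; exists f.
exact: inj_card_le g.
Qed.

Lemma card_le_rel T U (A : set T) (B : set U) (M : T -> U -> Prop) :
  (forall x, A x -> exists2 y, B y & M x y) ->
  (forall x x' y, A x -> A x' -> M x y -> M x' y -> x = x') ->
  (A #<= B)%card.
Proof.
move=> M_total M_inj.
have [[y0 _]|noU] := pselect (exists y : U, True); last first.
  suff -> : A = set0 by exact: card_ge0.
  by rewrite -subset0 => x /M_total[y]; case: noU; exists y.
have : forall x, exists y, A x -> B y /\ M x y.
  move=> x; have [/M_total[y By Mxy]|NAx] := pselect (A x); first by exists y.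
  by exists y0.
move=> /choice[f fP]; apply: (@inj_card_le_set _ _ _ _ f).
  by move=> x /fP[].
move=> x x' /set_mem Ax /set_mem Ax' fxx'.
have [_ Mx] := fP _ Ax; have [_ Mx'] := fP _ Ax'.
by apply: M_inj Ax Ax' Mx _; rewrite fxx'.
Qed.

(** Zorn's lemma for the graphs of partial injections from [A] to [B], ordered by inclusion: a
    maximal graph is total on [A] or onto [B], since otherwise a pair of missed points could be
    added to it. *)
Lemma card_le_total T U (A : set T) (B : set U) :
  (A #<= B)%card \/ (B #<= A)%card.
Proof.
pose P (M : set (T * U)) :=
  [/\ forall x y, M (x, y) -> A x /\ B y,
      forall x y y', M (x, y) -> M (x, y') -> y = y' &
      forall x x' y, M (x, y) -> M (x', y) -> x = x'].
have [|M [[MAB M_fun M_inj] M_max]] := @Zorn_bigcup _ P.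
  move=> F FP F_tot.
  have F2 p q : (\bigcup_(M in F) M) p -> (\bigcup_(M in F) M) q ->
      exists M, [/\ F M, M p & M q].
    move=> [M FM Mp] [N FN Nq].
    by have [MN|NM] := F_tot _ _ FM FN; [exists N|exists M]; split=> //;
      [exact: MN|exact: NM].
  split.
  - by move=> x y [M /FP[+ _ _]] => /[apply].
  - by move=> x y y' p q; have [M [/FP[_ Mf _] /Mf]] := F2 _ _ p q; apply.
  - by move=> x x' y p q; have [M [/FP[_ _ Mi] /Mi]] := F2 _ _ p q; apply.
have [dom|] := pselect (forall x, A x -> exists y, M (x, y)).
  left; apply: (@card_le_rel _ _ _ _ (fun x y => M (x, y))) => [x /dom[y Mxy]|].
    by exists y => //; have [] := MAB _ _ Mxy.
  by move=> x x' y _ _; exact: M_inj.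
move=> /existsNP[x /not_implyP[Ax /forallNP xM]].
have [ran|] := pselect (forall y, B y -> exists x, M (x, y)).
  right; apply: (@card_le_rel _ _ _ _ (fun y x => M (x, y))) => [y /ran[z Mzy]|].
    by exists z => //; have [] := MAB _ _ Mzy.
  by move=> y y' z _ _; exact: M_fun.
move=> /existsNP[y /not_implyP[By /forallNP yM]].
case: (M_max (M `|` [set (x, y)])).
  split; last by move=> /(_ (x, y) (or_intror erefl)) /xM.
  by move=> p Mp; left.
split.
- by move=> x' y' [/MAB//|[-> ->]].
- move=> x' z z' [Mz|[ex ez]] [Mz'|[ex' ez']]; last by rewrite ez ez'.
  + exact: M_fun Mz Mz'.
  + by case: (xM z); rewrite -ex'.
  + by case: (xM z'); rewrite -ex.
- move=> z z' y' [Mz|[ez ey]] [Mz'|[ez' ey']]; last by rewrite ez ez'.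
  + exact: M_inj Mz Mz'.
  + by case: (yM z); rewrite -ey'.
  + by case: (yM z'); rewrite -ey.
Qed.

(** * Sets smaller than a regular cardinal, and fresh variables *)

Section Regular.
Variables (V : Type) (K : set V).
Hypothesis K_regular : regular K.

Lemma regular_point : exists k, K k.
Proof. by have [/infinite_setN0 ? _] := K_regular. Qed.

Lemma below_card_le T (A : set T) : below K A -> (A #<= K)%card.
Proof. by move=> nKA; have [] := card_le_total A K. Qed.

Lemma below_le T U (A : set T) (B : set U) :
  (A #<= B)%card -> below K B -> below K A.
Proof. by move=> AB nKB KA; apply/nKB/(card_le_trans KA). Qed.

Lemma below_sub T (A B : set T) : A `<=` B -> below K B -> below K A.
Proof. by move=> /subset_card_le; exact: below_le. Qed.

Lemma below_finite T (A : set T) : finite_set A -> below K A.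
Proof.
move=> A_fin KA; have [K_inf _] := K_regular.
exact/K_inf/(card_le_finite KA).
Qed.

(** Transfers [regular] from subsets of [V] to arbitrary types. If [g] embeds [K] into the union,
    let [h k] be an index of a member containing [g k]. Then [K] is the union of the fibres of
    [f \o h]; there are fewer than [K] of them, and the one over [f i] embeds by [g] into [A i]. *)
Lemma below_bigcup I T (J : set I) (A : I -> set T) :
  below K J -> (forall i, J i -> below K (A i)) ->
  below K (\bigcup_(i in J) A i).
Proof.
move=> J_below A_below K_le.
have [k0 Kk0] := regular_point.
have [f fK f_inj] := card_le_inj k0 (below_card_le J_below).
have [[t _]|noT] := pselect (exists t : T, True); last first.
  move: K_le; suff -> : \bigcup_(i in J) A i = set0.
    by rewrite card_le0 => /eqP K0; move: Kk0; rewrite K0.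
  by rewrite -subset0 => t; case: noT; exists t.
have [g gA g_inj] := card_le_inj t K_le.
have : forall k, exists i, K k -> J i /\ A i (g k).
  move=> k; have [/gA[i Ji Ai]|nKk] := pselect (K k); first by exists i.
  have [i _] : exists i : I, True by have [i] := gA _ Kk0; exists i.
  by exists i.
move=> /choice[h hP].
have [_ reg] := K_regular.
pose C v := [set k | K k /\ f (h k) = v].
have : below K (\bigcup_(v in f @` J) C v).
  apply: reg => [|v [i Ji <-]].
    exact: below_le (card_image_le _ _) J_below.
  apply: below_le (A_below _ Ji).
  apply: (@inj_card_le_set _ _ _ _ g) =>
      [k [Kk /f_inj <-]|k k' /set_mem[Kk _] /set_mem[Kk' _]].
  - by have [] := hP _ Kk.
  - by rewrite inE; have [] := hP _ Kk.
  - by rewrite inE.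
  - by apply: g_inj; rewrite inE.
apply; apply: subset_card_le => k Kk; exists (f (h k)) => //.
by exists (h k) => //; have [] := hP _ Kk.
Qed.

Lemma below_setU T (A B : set T) : below K A -> below K B -> below K (A `|` B).
Proof.
move=> A_below B_below.
have <- : \bigcup_(b in [set: bool]) (if b then A else B) = A `|` B.
  apply/seteqP; split=> [x [[] _ ?]|x [Ax|Bx]]; [by left|by right| |].
    by exists true.
  by exists false.
by apply: below_bigcup => [|[]//]; exact: below_finite.
Qed.

(** Removing [W] leaves [K] as large as before, for otherwise [K] would be covered by two sets below
    [K]. *)
Lemma fresh_injection T (A : set T) (W : set V) :
  below K A -> below K W ->
  exists2 f : T -> V, set_inj A f & forall x, A x -> ~ W (f x).
Proof.
move=> A_below W_below; have [k0 _] := regular_point.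
have K_diff : (K #<= K `\` W)%card.
  apply: contrapT => KW_below.
  apply: (below_setU W_below KW_below); apply: subset_card_le => k Kk.
  by have [|] := pselect (W k); [left|right].
have [f f_fun f_inj] :=
  card_le_inj k0 (card_le_trans (below_card_le A_below) K_diff).
by exists f => // x /f_fun[].
Qed.

(** One fresh injection on all pairs [(X, Y)] separates the variables of all the terms at once, so
    that a single [zeta] can store every value [z X Y] without conflict. *)
Lemma disjoint_renaming D (J : set V) (A : V -> set V) (W : set V)
    (z : V -> V -> D) :
  below K J -> (forall X, J X -> below K (A X)) -> below K W ->
  exists (r : V -> V -> V) (zeta : V -> D), forall X Y, J X -> A X Y ->
    [/\ forall X' Y', J X' -> A X' Y' -> r X Y = r X' Y' -> X = X' /\ Y = Y',
        ~ W (r X Y) & zeta (r X Y) = z X Y].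
Proof.
move=> J_below A_below W_below.
pose P := \bigcup_(X in J) [set (X, Y) | Y in A X].
have P_below : below K P.
  apply: below_bigcup => // X JX.
  exact: below_le (card_image_le _ _) (A_below _ JX).
have [f f_inj f_fresh] := fresh_injection P_below W_below.
have in_P X Y : J X -> A X Y -> P (X, Y).
  by move=> JX AY; exists X => //; exists Y.
have f_inj2 p q : P p -> P q -> f p = f q -> p = q.
  by move=> Pp Pq; apply: f_inj; rewrite inE.
have /choice[zeta zetaP] : forall Z, exists d,
    forall p, P p -> f p = Z -> d = z p.1 p.2.
  move=> Z; have [[p [Pp fp]]|nop] := pselect (exists p, P p /\ f p = Z).
    by exists (z p.1 p.2) => q Pq fq; rewrite (f_inj2 q p) // fq.
  by exists (z Z Z) => p Pp fp; case: nop; exists p.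
exists (fun X Y => f (X, Y)), zeta => X Y JX AY; split.
- by move=> X' Y' JX' AY' /(f_inj2 _ _ (in_P _ _ JX AY) (in_P _ _ JX' AY'))[].
- by apply: f_fresh; exact: in_P.
- by rewrite (zetaP _ (X, Y)) //; exact: in_P.
Qed.

End Regular.

(** * Alpha-convertibility by matching of variables, and substitution *)

Section Alpha.
Variables (V : Type) (S : signature).
Implicit Types (c : S) (X Y Z : V) (E F G : expr V S) (R : V -> V -> Prop).
Implicit Types (s t : V -> expr V S).

(** The matching inside argument [i]: binders correspond slot by slot, and a pair of [R] survives
    only if it is shadowed on neither side. *)
Definition ext_binders c (b b' : binder c -> V) (i : arity c) R X Y :=
  (exists j, [/\ scope i j, X = b j & Y = b' j]) \/
  [/\ R X Y, ~ bound_in b i X & ~ bound_in b' i Y].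

(* [aeq R E F]: E and F agree up to the names of bound variables, and R relates
   the free variables of E to those at the same positions of F.  Thus
   [aeq eq] is alpha-convertibility, without any reference to substitution. *)
Inductive aeq : (V -> V -> Prop) -> expr V S -> expr V S -> Prop :=
| aeq_var R X Y : R X Y -> aeq R (Var X) (Var Y)
| aeq_con R c (b b' : binder c -> V) (hb : admissible b) (hb' : admissible b')
    (a a' : arity c -> expr V S) :
    (forall i, aeq (ext_binders b b' i R) (a i) (a' i)) ->
    aeq R (Con c b hb a) (Con c b' hb' a').

Lemma aeq_varP R X F : aeq R (Var X) F -> exists2 Y, F = Var Y & R X Y.
Proof.
pose P E := if E is Var X then exists2 Y, F = Var Y & R X Y else True.
move=> RXF; change (P (Var X)).
by case: R (Var X) F / RXF @P => //= R X' Y; exists Y.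
Qed.

(** Inversion by cases on a goal that matches on the expression, so that no equality between the
    dependent arguments of [Con] arises. *)
Lemma aeq_conP R c (b : binder c -> V) hb a F : aeq R (Con c b hb a) F ->
  exists b' hb' a', F = Con c b' hb' a' /\
    forall i, aeq (ext_binders b b' i R) (a i) (a' i).
Proof.
pose P E := if E is Con c b hb a then
  exists b' hb' a', F = Con c b' hb' a' /\
    forall i, aeq (ext_binders b b' i R) (a i) (a' i) else True.
move=> RXF; change (P (Con c b hb a)).
case: R (Con c b hb a) F / RXF @P => //= {}R {}c {}b b' {}hb hb' {}a a' aa'.
by exists b', hb', a'.
Qed.

Lemma is_subst_varP s X G : is_subst s (Var X) G -> G = s X.
Proof.
pose P E := if E is Var X then G = s X else True.
by move=> sG; change (P (Var X)); case: s (Var X) G / sG @P.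
Qed.

Lemma is_subst_conP s c (b : binder c -> V) hb a G :
  is_subst s (Con c b hb a) G -> exists b' hb' a' u,
  [/\ G = Con c b' hb' a',
      forall j, (forall i, scope i j -> ~ incoming b a s i (b j)) -> b' j = b j,
      forall i j, scope i j -> ~ incoming b a s i (b' j),
      forall i, under_binders b b' i s (u i) &
      forall i, is_subst (u i) (a i) (a' i)].
Proof.
pose P E := if E is Con c b hb a then exists b' hb' a' u,
  [/\ G = Con c b' hb' a',
      forall j, (forall i, scope i j -> ~ incoming b a s i (b j)) -> b' j = b j,
      forall i j, scope i j -> ~ incoming b a s i (b' j),
      forall i, under_binders b b' i s (u i) &
      forall i, is_subst (u i) (a i) (a' i)] else True.
move=> sG; change (P (Con c b hb a)).
case: s (Con c b hb a) G / sG @P => //= s' c' b1 b' hb1 hb' a1 a' u *.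
by exists b', hb', a', u.
Qed.

Lemma aeq_weaken R R' E F : aeq R E F ->
  (forall X Y, fv E X -> fv F Y -> R X Y -> R' X Y) -> aeq R' E F.
Proof.
move=> RF; elim: RF R' => [R0 X Y RXY|R0 c b b' hb hb' a a' _ IH] R' RR'.
  by constructor; apply: RR'.
constructor=> i; apply: IH => X Y EX FY [|[RXY bX bY]]; first by left.
by right; split=> //; apply: RR' => //; exists i.
Qed.

Lemma aeq_refl R E : (forall X, fv E X -> R X X) -> aeq R E E.
Proof.
elim: E R => [X|c b hb a IH] R RE; first by constructor; exact: RE.
constructor=> i; apply: IH => X aX.
have [[j ij bjX]|bX] := pselect (bound_in b i X); first by left; exists j.
by right; split=> //; apply: RE; exists i.
Qed.

Lemma aeq_sym R E F : aeq R E F -> aeq (fun X Y => R Y X) F E.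
Proof.
elim=> [R0 X Y RXY|R0 c b b' hb hb' a a' _ IH]; first by constructor.
constructor=> i; apply: aeq_weaken (IH i) _ => X Y _ _ [[j [ij -> ->]]|[]].
  by left; exists j.
by right.
Qed.

Lemma aeq_trans R R' E F G : aeq R E F -> aeq R' F G ->
  aeq (fun X Z => exists2 Y, R X Y & R' Y Z) E G.
Proof.
move=> RF; elim: RF R' G => [R0 X Y RXY|R0 c b b' hb hb' a a' _ IH] R' G.
  by move=> /aeq_varP[Z -> R'YZ]; constructor; exists Y.
move=> /aeq_conP[b2 [hb2 [a2 [-> aa2]]]]; constructor=> i.
apply: aeq_weaken (IH i _ _ (aa2 i)) _ => X Z _ _ [Y].
move=> [[j [ij -> ->]]|[RXY bX bY]] [[k [ik Yk ->]]|[RYZ bY' bZ]].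
- by left; exists j; rewrite (hb' _ _ _ ij ik Yk).
- by case: bY'; exists j.
- by case: bY; exists k.
- by right; split=> //; exists Y.
Qed.

Lemma aeq_fv R E F X : aeq R E F -> fv E X -> exists2 Y, fv F Y & R X Y.
Proof.
move=> RF; elim: RF X => [R0 X Y RXY|R0 c b b' hb hb' a a' _ IH] X'.
  by move=> ->; exists Y.
move=> [i _ [/IH[Y aY [[j [ij -> _]]|[RXY _ bY]]] bX]].
  by case: bX; exists j.
by exists Y => //; exists i.
Qed.

Lemma fv_subst s E G Y : is_subst s E G -> fv G Y ->
  exists2 X, fv E X & fv (s X) Y.
Proof.
move=> sG; elim: sG Y => [s' X|s' c b b' hb hb' a a' t _ _ t_under _ IH] Y sY.
  by exists X.
have [i _ [/IH[X aX tY] bY]] := sY; have [t_bound t_free] := t_under i.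
have [[j ij bjX]|bX] := pselect (bound_in b i X); last first.
  by exists X; [exists i|rewrite -t_free].
by case: bY; exists j => //; move: tY; rewrite -bjX t_bound.
Qed.

(** Induction on the matching. Under binders, matched slots go to matched new names, and the absence
    of capture keeps the pairs coming from [s] and [s'] unshadowed. *)
Lemma aeq_subst R R' s s' E E' G G' : aeq R E E' ->
  is_subst s E G -> is_subst s' E' G' ->
  (forall X Y, fv E X -> fv E' Y -> R X Y -> aeq R' (s X) (s' Y)) ->
  aeq R' G G'.
Proof.
move=> RE; elim: RE R' s s' G G' =>
  [R0 X Y RXY|R0 c b b' hb hb' a a' _ IH] R' s s' G G'.
  by move=> /is_subst_varP -> /is_subst_varP ->; exact.
move=> /is_subst_conP[b1 [hb1 [a1 [t [-> _ nocapt tP aP]]]]].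
move=> /is_subst_conP[b1' [hb1' [a1' [t' [-> _ nocapt' tP' aP']]]]] ss'.
constructor=> i; apply: (IH i _ _ _ _ _ (aP i) (aP' i)) => X Y aX aY.
have [t_bound t_free] := tP i; have [t'_bound t'_free] := tP' i.
move=> [[j [ij -> ->]]|[RXY bX bY]].
  by rewrite t_bound // t'_bound //; constructor; left; exists j.
rewrite t_free // t'_free //; apply: aeq_weaken.
  by apply: ss' RXY; exists i.
move=> X' Y' sX' sY' RXY'; right; split=> // -[j ij bj].
  by apply: (nocapt i j ij); exists X => //; rewrite bj.
by apply: (nocapt' i j ij); exists Y => //; rewrite bj.
Qed.

Lemma aeq_rename R s E G : is_subst s E G ->
  (forall X, fv E X -> exists2 Y, s X = Var Y & R X Y) -> aeq R E G.
Proof.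
move=> sG; elim: sG R => [s' X|s' c b b' hb hb' a a' t _ nocapt tP _ IH] R sR.
  by have [//|Y -> RXY] := sR X; constructor.
constructor=> i; apply: IH => X aX; have [t_bound t_free] := tP i.
have [[j ij <-]|bX] := pselect (bound_in b i X).
  by exists (b' j); [exact: t_bound|left; exists j].
have [|Y sXY RXY] := sR X; first by exists i.
exists Y; first by rewrite t_free.
right; split=> // -[j ij bj]; apply: (nocapt i j ij); exists X => //.
by rewrite sXY.
Qed.

Lemma alpha_aeq E F : alpha E F -> aeq eq E F.
Proof.
elim=> [{}E|{}E {}F _|{}E {}F G _ EF _ FG|c b hb a a' _ IH|].
- exact: aeq_refl.
- by move=> /aeq_sym EF; apply: aeq_weaken EF _.
- by apply: aeq_weaken (aeq_trans EF FG) _ => X Z _ _ [Y ->].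
- constructor=> i; apply: aeq_weaken (IH i) _ => X Y _ _ <-.
  have [[j ij bj]|bX] := pselect (bound_in b i X); first by left; exists j.
  by right.
- move=> c b b' hb hb' a a' t b'_fresh tP aP; constructor=> i.
  apply: (aeq_rename (aP i)) => X aX; have [t_bound t_free] := tP i.
  have [[j ij <-]|bX] := pselect (bound_in b i X).
    by exists (b' j); [exact: t_bound|left; exists j].
  exists X; first exact: t_free.
  by right; split=> // -[j ij bj]; apply: (b'_fresh i j ij); rewrite bj.
Qed.

Lemma alpha_fv E F X : alpha E F -> fv E X -> fv F X.
Proof. by move=> /alpha_aeq EF /(aeq_fv EF)[Y FY ->]. Qed.

(** Names in binder slots count even where they bind nothing, so that a name outside [vars E]
    differs from every binder of [E]. *)
Fixpoint vars E : set V :=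
  match E with
  | Var X => [set X]
  | Con c b _ a => range b `|` \bigcup_(i in [set: arity c]) vars (a i)
  end.

Lemma fv_vars E : fv E `<=` vars E.
Proof.
elim: E => [X|c b hb a IH] //= X [i _ [/IH aX _]].
by right; exists i.
Qed.

(* Neither substitution has to rename a binder, so that the round trip restores
   E itself, and not just a term alpha-convertible to it. *)
Lemma rename_back s t E F G : is_subst s E F -> is_subst t F G ->
  (forall X, fv E X -> exists Y,
     [/\ s X = Var Y, t Y = Var X & Y = X \/ ~ vars E Y]) ->
  G = E.
Proof.
move=> sF; elim: sF t G => [s' X|s' c b b' hb hb' a a' u b_keep _ uP aP IH] t G.
  move=> tG /(_ X erefl)[Y [sX tY _]].
  by rewrite sX in tG; rewrite (is_subst_varP tG).
move=> /is_subst_conP[b2 [hb2 [a2 [w [-> b2_keep _ wP a2P]]]]] stE.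
(* A captured [b j] would be the new name of a free variable [X]. That name is either outside
   [vars E], hence no binder, or [X] itself, which is not bound here. *)
have eq_b : b' = b.
  apply: funext => j; apply: b_keep => i ij [X [aX bX] sX].
  have [|Y [sXY _ YX]] := stE X; first by exists i.
  move: sX; rewrite sXY /= => bjY; case: YX => [YX|]; last first.
    by rewrite -bjY; apply; left; exists j.
  by apply: bX; exists j => //; rewrite bjY.
rewrite {b' b_keep}eq_b in hb' uP b2_keep wP.
(* On the way back, [t] sends [Y] to a variable [X] that is not bound in argument [i], so [b j]
   cannot be captured. *)
have eq_b2 : b2 = b.
  apply: funext => j; apply: b2_keep => i ij [Y [a'Y bY] tY].
  have [X aX uX] := fv_subst (aP i) a'Y; have [u_bound u_free] := uP i.
  have [[k ik bk]|bX] := pselect (bound_in b i X).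
    by apply: bY; exists k => //; move: uX; rewrite -bk u_bound.
  have [|Y' [sXY tYX _]] := stE X; first by exists i.
  move: uX tY; rewrite u_free // sXY => /= ->; rewrite tYX => /= bjX.
  by apply: bX; exists j.
move: hb2 wP; rewrite {b2 b2_keep}eq_b2 => hb2 wP.
rewrite (Prop_irrelevance hb2 hb); congr Con; apply: funext => i.
apply: (IH _ _ _ (a2P i)) => X aX.
have [u_bound u_free] := uP i; have [w_bound w_free] := wP i.
have [[j ij <-]|bX] := pselect (bound_in b i X).
  by exists (b j); rewrite u_bound // w_bound //; split=> //; left.
have [|Y [sX tY YX]] := stE X; first by exists i.
exists Y; rewrite u_free //; case: YX => [eYX|YE].
  by rewrite eYX in sX tY *; rewrite w_free //; split=> //; left.
rewrite w_free; last by move=> [j _ bj]; apply: YE; left; exists j.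
by split=> //; right=> aY; apply: YE; right; exists i.
Qed.

Lemma under_bindersE c (b b' : binder c -> V) (i : arity c) s :
  admissible b -> exists t, under_binders b b' i s t.
Proof.
move=> hb.
suff /choice[t tP] : forall X, exists E,
    (forall j, scope i j -> b j = X -> E = Var (b' j)) /\
    (~ bound_in b i X -> E = s X).
  exists t; split=> [j ij|X]; first exact: (tP _).1.
  exact: (tP _).2.
move=> X; have [[j ij bj]|bX] := pselect (bound_in b i X).
  exists (Var (b' j)); split=> [k ik bk|[]]; last by exists j.
  by rewrite (hb i j k ij ik) // bj bk.
by exists (s X); split=> // j ij bj; case: bX; exists j.
Qed.

(** * From matching along equality back to [alpha], by means of fresh binders *)

Variable K : set V.
Hypothesis K_regular : regular K.
Hypothesis K_large : forall c : S,
  below K [set: arity c] /\ below K [set: binder c].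

Lemma below_vars E : below K (vars E).
Proof.
elim: E => [X|c b hb a IH]; first by apply: (below_finite K_regular); exact: finite_set1.
have [ar_c bi_c] := K_large c; apply: (below_setU K_regular).
  exact: below_le (card_image_le _ _) bi_c.
exact: (below_bigcup K_regular).
Qed.

Lemma below_fv E : below K (fv E).
Proof. exact: below_sub (@fv_vars E) (@below_vars E). Qed.

Hypothesis subst_total : forall (s : V -> expr V S) E, exists F, is_subst s E F.

Lemma alpha_rename_total c (b b' : binder c -> V) (hb : admissible b)
    (hb' : admissible b') (a : arity c -> expr V S) :
  (forall i j, ~ fv (a i) (b' j)) ->
  exists2 a', alpha (Con c b hb a) (Con c b' hb' a') &
    forall i, aeq (ext_binders b b' i eq) (a i) (a' i).
Proof.
move=> b'_fresh.
have /choice[t tP] i := under_bindersE b' i Var hb.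
have /choice[a' aP] i := subst_total (t i) (a i).
have b'_fresh2 i j : scope i j -> ~ (fv (a i) `\` bound_in b i) (b' j).
  by move=> _ [/b'_fresh].
exists a' => [|i]; first exact: alpha_rename tP aP.
apply: aeq_rename (aP i) _ => X aX; have [t_bound t_free] := tP i.
have [[j ij <-]|bX] := pselect (bound_in b i X).
  by exists (b' j); [exact: t_bound|left; exists j].
exists X; first exact: t_free.
by right; split=> // -[j ij bj]; apply: (b'_fresh i j); rewrite bj.
Qed.

(* E only serves as the shape on which to do induction, since the arguments of
   E' and F' get renamed before the induction hypothesis applies to them. *)
Lemma aeq_alpha_shape R E E' F' : aeq R E E' -> aeq eq E' F' -> alpha E' F'.
Proof.
elim: E R E' F' => [X|c b hb a IH] R E' F'.
  by move=> /aeq_varP[Y -> _] /aeq_varP[_ -> <-]; exact: alpha_refl.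
move=> /aeq_conP[b1 [hb1 [a1 [-> aa1]]]] /aeq_conP[b2 [hb2 [a2 [-> a12]]]].
have [ar_c bi_c] := K_large c.
have W_below :
    below K (\bigcup_(i in [set: arity c]) (fv (a1 i) `|` fv (a2 i))).
  by apply: (below_bigcup K_regular) => // i _;
    apply: (below_setU K_regular); exact: below_fv.
(* Both sides are renamed to the same binders [b'], after which [alpha_cong] reduces the claim to
   the arguments. *)
have [b' b'_inj b'_fresh] := fresh_injection K_regular bi_c W_below.
have hb' : admissible b' by move=> i j k _ _; apply: b'_inj; rewrite inE.
have [|g1 ag1 rg1] := @alpha_rename_total c b1 b' hb1 hb' a1.
  by move=> i j ?; apply: (b'_fresh j) => //; exists i => //; left.
have [|g2 ag2 rg2] := @alpha_rename_total c b2 b' hb2 hb' a2.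
  by move=> i j ?; apply: (b'_fresh j) => //; exists i => //; right.
apply: alpha_trans ag1 (alpha_trans _ (alpha_sym ag2)).
apply: alpha_cong => i; apply: IH (aeq_trans (aa1 i) (rg1 i)) _.
(* The matchings from [g1 i] through [a1 i] and [a2 i] to [g2 i] compose to equality: admissibility
   of [b1] and [b2] identifies the slots, and no intermediate variable is bound in one matching and
   free in the next. *)
apply: aeq_weaken (aeq_trans (aeq_sym (rg1 i)) (aeq_trans (a12 i) (rg2 i))) _.
move=> X Z _ _ [Y].
move=> [[j [ij -> ->]]|[-> bY bX]] [U].
  move=> [[k [ik jk ->]]|[<- bj bj2]]; last by case: bj; exists j.
  move: jk => /(hb1 i _ _ ij ik) <-.
  move=> [[l [il kl ->]]|[<- bk bk2]]; last by case: bk; exists j.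
  by rewrite (hb2 i _ _ ij il kl).
move=> [[k [ik Xk]]|[<- b1X b2X]]; first by case: bY; exists k.
move=> [[l [il Xl]]|[<-]] //.
by case: b2X; exists l.
Qed.

Lemma aeq_alpha E F : aeq eq E F -> alpha E F.
Proof. by apply: aeq_alpha_shape; exact: (@aeq_refl eq E). Qed.

Lemma alpha_subst s s' E E' G G' : alpha E E' ->
  is_subst s E G -> is_subst s' E' G' ->
  (forall X, fv E X -> alpha (s X) (s' X)) -> alpha G G'.
Proof.
move=> /alpha_aeq EE' sG sG' ss'; apply: aeq_alpha.
by apply: aeq_subst EE' sG sG' _ => X _ EX _ <-; exact/alpha_aeq/ss'.
Qed.

End Alpha.

(** * Semantic alpha-equivalence is a congruence *)

Section Semantics.
Variables (V D : Type) (L : language V D) (K : set V).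
Hypothesis K_regular : regular K.
Hypothesis K_large : forall c : syntax L,
  below K [set: arity c] /\ below K [set: binder c].
Hypothesis L_alpha : alpha_postulate L.
Implicit Types (E F : term L) (s : V -> term L) (rho zeta : V -> D).

Lemma subst_totalL s E : exists F, is_subst s E F.
Proof. by exists (sub E s); exact: subP. Qed.

Lemma alpha_sem_alpha E F zeta : alpha E F ->
  alpha_sem L (sem E zeta) (sem F zeta).
Proof. by move=> EF; exists E, F, zeta. Qed.

Lemma alpha_sem_sub E s zeta :
  alpha_sem L (sem (sub E s) zeta) (sem E (fun X => sem (s X) zeta)).
Proof. by have [F FE ->] := sem_sub E s zeta; exact: alpha_sem_alpha. Qed.

Lemma alpha_sem_rename E s (f : V -> V) rho zeta :
  (forall X, fv E X -> s X = Var (f X) /\ zeta (f X) = rho X) ->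
  alpha_sem L (sem (sub E s) zeta) (sem E rho).
Proof.
move=> sf; suff <- : sem E (fun X => sem (s X) zeta) = sem E rho.
  exact: alpha_sem_sub.
by apply: sem_fv => X /sf[-> <-]; rewrite sem_var.
Qed.

(* Undoing the renaming recovers E on the nose, so that [sem_sub], applied to
   the inverse renaming, gives an equality rather than [alpha_sem]. *)
Lemma sem_rename E (f : V -> V) rho zeta :
  (forall X Y, fv E X -> fv E Y -> f X = f Y -> X = Y) ->
  (forall X, fv E X -> ~ vars E (f X)) ->
  (forall X, fv E X -> zeta (f X) = rho X) ->
  exists2 F, alpha F (sub E (fun X => Var (f X))) & sem F zeta = sem E rho.
Proof.
move=> f_inj f_fresh f_rho; set H := sub _ _.
have /choice[g gP] : forall Z, exists G : term L,
    forall X, fv E X -> f X = Z -> G = Var X.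
  move=> Z; have [[X [EX fX]]|noX] := pselect (exists X, fv E X /\ f X = Z).
    by exists (Var X) => Y EY fY; congr Var; apply: f_inj => //; rewrite fX.
  by exists (Var Z) => X EX fX; case: noX; exists X.
have gfE : sub H g = E.
  apply: (rename_back (subP E _) (subP H g)) => X EX.
  by exists (f X); split=> //; [exact: gP|right; exact: f_fresh].
have [F FH] := sem_sub H g rho; rewrite gfE => ->; exists F => //.
apply: sem_fv => Z /(alpha_fv FH) /(fv_subst (subP _ _))[X EX ->].
by rewrite f_rho // (gP _ _ EX erefl) sem_var.
Qed.

(** Terms witnessing the equivalence of [rho X] and [rho' X] are renamed apart. By [sem_rename], the
    resulting [s X] and [s' X] take exactly these values under one [zeta]. Both sides are then
    equivalent to the values of the alpha-convertible terms [sub E s] and [sub E s']. *)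
Lemma alpha_sem_congr E rho rho' :
  (forall X, fv E X -> alpha_sem L (rho X) (rho' X)) ->
  alpha_sem L (sem E rho) (sem E rho').
Proof.
move=> rho_rho'.
have /choice[w wP] : forall X, exists w : term L * term L * (V -> D),
    fv E X -> [/\ alpha w.1.1 w.1.2, sem w.1.1 w.2 = rho X
                & sem w.1.2 w.2 = rho' X].
  move=> X; have [/rho_rho'[F [F' [z [FF' Fz F'z]]]]|EX] := pselect (fv E X).
    by exists (F, F', z).
  by exists (Var X, Var X, rho).
pose F X := (w X).1.1; pose F' X := (w X).1.2.
have E_below : below K (fv E) by exact: below_fv.
(* All variables of both witnesses are avoided, bound ones included, as [sem_rename] will be applied
   to each of them. *)
have [|X EX||r [zeta rP]] := @disjoint_renaming _ _ K_regular D (fv E)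
    (fun X => fv (F X)) (\bigcup_(X in fv E) (vars (F X) `|` vars (F' X)))
    (fun X => (w X).2) => //.
- exact: below_fv.
- apply: (below_bigcup K_regular) => // X _.
  by apply: (below_setU K_regular); exact: below_vars.
(* Hence [r X] and [zeta], prescribed on the free variables of [F X], serve [F' X] as well. *)
have F'F X Y : fv E X -> fv (F' X) Y -> fv (F X) Y.
  by move=> /wP[FF' _ _]; exact: alpha_fv (alpha_sym FF').
have /choice[s sP] : forall X, exists G : term L, fv E X ->
    alpha G (sub (F X) (fun Y => Var (r X Y))) /\ sem G zeta = rho X.
  move=> X; have [EX|EX] := pselect (fv E X); last by exists (Var X).
  have [_ FX _] := wP X EX.
  have [|Y FY|Y FY|G GF Gz] := @sem_rename (F X) (r X) (w X).2 zeta.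
  - by move=> Y Y' FY FY' /(let: And3 i _ _ := rP _ _ EX FY in i _ _ EX FY')[].
  - by have [_ rW _] := rP _ _ EX FY => FrY; apply: rW; exists X => //; left.
  - by have [] := rP _ _ EX FY.
  - by exists G; rewrite Gz.
have /choice[s' sP'] : forall X, exists G : term L, fv E X ->
    alpha G (sub (F' X) (fun Y => Var (r X Y))) /\ sem G zeta = rho' X.
  move=> X; have [EX|EX] := pselect (fv E X); last by exists (Var X).
  have [_ _ FX] := wP X EX; have {}F'F := F'F X _ EX.
  have [|Y /F'F FY|Y /F'F FY|G GF Gz] := @sem_rename (F' X) (r X) (w X).2 zeta.
  - move=> Y Y' /F'F FY /F'F FY'.
    by move=> /(let: And3 i _ _ := rP _ _ EX FY in i _ _ EX FY')[].
  - by have [_ rW _] := rP _ _ EX FY => FrY; apply: rW; exists X => //; right.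
  - by have [] := rP _ _ EX FY.
  - by exists G; rewrite Gz.
have ss' X : fv E X -> alpha (s X) (s' X).
  move=> EX; have [sF _] := sP X EX; have [sF' _] := sP' X EX.
  have [FF' _ _] := wP X EX.
  apply: alpha_trans sF (alpha_trans _ (alpha_sym sF')).
  apply: (alpha_subst K_regular K_large subst_totalL FF' (subP _ _) (subP _ _)).
  by move=> Y _; exact: alpha_refl.
have [_ asem_sym asem_trans] := L_alpha.
have <- : sem E (fun X => sem (s X) zeta) = sem E rho.
  by apply: sem_fv => X /sP[].
have <- : sem E (fun X => sem (s' X) zeta) = sem E rho'.
  by apply: sem_fv => X /sP'[].
apply: (asem_trans _ _ _ (asem_sym _ _ (alpha_sem_sub _ _ _))).
apply: (asem_trans _ _ _ _ (alpha_sem_sub _ _ _)); apply: alpha_sem_alpha.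
apply: (alpha_subst K_regular K_large subst_totalL _ (subP _ _) (subP _ _)) => //.
exact: alpha_refl.
Qed.

End Semantics.

(** * Correctness of the translation with respect to the chosen relation *)

Theorem theorem8 (V U : Type) (D D' : set U)
    (L : language V D) (L' : language V D') (le : U -> U -> Prop)
    (hV : sufficiently_large V (syntax L)) (hV' : sufficiently_large V (syntax L'))
    (hL : alpha_postulate L) (hL' : alpha_postulate L')
    (le_pre : PreOrder le)
    (le_alpha : respects_alpha le L) (le_alpha' : respects_alpha le L')
    (T : term L -> term L') :
  compositional T -> fvr_translation T -> preserves le T ->
  valid_up_to le T.
Proof.
move=> [T_sub T_alpha T_var] T_fv [TT TT_le T_le].
have [K K_regular K_large] := hV; have [K' K'_regular K'_large] := hV'.
have [asem_refl asem_sym asem_trans] := hL.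
have [asem_refl' asem_sym' asem_trans'] := hL'.
have [le_refl le_trans] := le_pre.
exists (fun v' v => exists (E : term L) (rho : V -> D),
  alpha_sem L' v' (sem (T E) (TT \o rho)) /\ alpha_sem L (sem E rho) v).
split.
(* A variable under a constant valuation relates [TT v] to [v], because [T] fixes variables. *)
- move=> v; have [X _] := regular_point K_regular.
  exists (TT v); exists (Var X), (fun=> v); rewrite T_var !sem_var.
  by split; [exact: asem_refl'|exact: asem_refl].
- move=> v' v [E [rho [/le_alpha' v'E /le_alpha Ev]]].
  exact: le_trans v'E (le_trans _ _ _ (T_le E rho) Ev).
move=> E eta rho eta_rho.
have /choice[w wP] : forall X, exists w : term L * (V -> D),
    alpha_sem L' (eta X) (sem (T w.1) (TT \o w.2)) /\
    alpha_sem L (sem w.1 w.2) (rho X).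
  by move=> X; have [F [z FP]] := eta_rho X; exists (F, z).
(* The avoided set is empty: values matter only up to [alpha_sem] here, so [alpha_sem_rename] takes
   the place of [sem_rename]. *)
have [|X EX||r [zeta rP]] := @disjoint_renaming _ _ K_regular D (fv E)
    (fun X => fv (w X).1) set0 (fun X => (w X).2).
- exact: below_fv.
- exact: below_fv.
- by apply: (below_finite K_regular); exact: finite_set0.
(* Both [q X] and, below, [s] are the identity off the free variables concerned, as [compositional]
   demands of the substitutions it speaks about. *)
have /choice[q qP] : forall X, exists q : V -> term L, forall Y,
    (fv (w X).1 Y -> q Y = Var (r X Y)) /\ (~ fv (w X).1 Y -> q Y = Var Y).
  move=> X; suff /choice[t tP] : forall Y, exists G : term L,
      (fv (w X).1 Y -> G = Var (r X Y)) /\ (~ fv (w X).1 Y -> G = Var Y).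
    by exists t.
  move=> Y; have [wY|wY] := pselect (fv (w X).1 Y); last by exists (Var Y).
  by exists (Var (r X Y)).
have /choice[s sP] : forall X, exists G : term L,
    (fv E X -> G = sub (w X).1 (q X)) /\ (~ fv E X -> G = Var X).
  move=> X; have [EX|EX] := pselect (fv E X); last by exists (Var X).
  by exists (sub (w X).1 (q X)).
exists (sub E s), zeta; split; last first.
  apply: (asem_trans _ _ _ (alpha_sem_sub _ _ _)).
  apply: (alpha_sem_congr K_regular K_large hL) => X EX; rewrite (sP X).1 //.
  have [_ wX] := wP X; apply: (asem_trans _ _ _ _ wX).
  apply: (@alpha_sem_rename _ _ _ _ _ (r X)) => Y wY.
  by rewrite (qP X Y).1 //; have [] := rP _ _ EX wY.
have TE : alpha (T (sub E s)) (sub (T E) (T \o s)).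
  by apply: T_sub => X EX; rewrite (sP X).2.
apply: (asem_trans' _ _ _ _ (asem_sym' _ _ (alpha_sem_alpha _ TE))).
apply: (asem_trans' _ _ _ _ (asem_sym' _ _ (alpha_sem_sub _ _ _))).
(* The inclusion [T_fv] ensures that only variables free in [E] matter here, and these have renamed
   witnesses. It is used likewise for each [T (w X).1] at the end. *)
apply: (alpha_sem_congr K'_regular K'_large hL') => X /T_fv EX /=.
rewrite (sP X).1 //; have [wX _] := wP X; apply: (asem_trans' _ _ _ wX).
have TF : alpha (T (sub (w X).1 (q X))) (sub (T (w X).1) (T \o q X)).
  by apply: T_sub => Y wY; rewrite (qP X Y).2.
apply: (asem_trans' _ _ _ _ (asem_sym' _ _ (alpha_sem_alpha _ TF))).
apply: asem_sym'; apply: (@alpha_sem_rename _ _ _ _ _ (r X)) => Y /T_fv wY /=.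
by rewrite (qP X Y).1 // T_var; have [_ _ ->] := rP _ _ EX wY.
Qed.
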